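(* Let $\Phi:\mathbb{C}^n\to\mathbb{R}$ be continuous and semiconvex with constant $\delta>0$, and let $u$ be $q$-plurisubharmonic on a non-empty open set $U\subset\mathbb{C}^n$, for an integer $q\geq 0$. Given a constant Hermitian matrix $\mathcal{A}\in\mathbb{C}^{n\times n}$, define $g(y)=y^t\mathcal{A}\overline{y}$ for $y\in\mathbb{C}^n$, and suppose that the proper set of definition for the sup-convolution $[u+g]_U^\Phi$ has non-empty interior $W\neq\emptyset$. Then the restriction of $[u+g]_U^\Phi-g$ to $W$ is continuous and $q$-plurisubharmonic on $W$.
   Context: Definitions. Let $U\subset\mathbb{C}^n$ be open and $u:U\to[-\infty,\infty)$ upper semi-continuous. (i) $u$ is subpluriharmonic on $U$ if either $u\equiv-\infty$ on $U$, or for every compact ball $\overline{B}\subset U$ and every continuous plurisubharmonic function $h$ defined in a neighborhood of $\overline{B}$, the restriction of $u+h$ to $\overline{B}$ attains its maximum on the boundary $bB$. (ii) For an integer $0\leq q<n$, $u$ is $q$-plurisubharmonic on $U$ if it is subpluriharmonic on $U\cap\pi$ for every $(q+1)$-dimensional complex affine subspace $\pi$ of $\mathbb{C}^n$ (where $\pi$ is identified with $\mathbb{C}^{q+1}$). For integers $q\geq n$, by convention every upper semi-continuous function is $q$-plurisubharmonic. (iii) For a non-empty set $X\subset\mathbb{C}^n$ and upper semi-continuous functions $v:X\to[-\infty,\infty)$ and $\Phi:\mathbb{C}^n\to[-\infty,\infty)$, the sup-convolution is $v_X^\Phi(y):=\sup_{x\in X}\{v(x)+\Phi(y-x)\}\in[-\infty,\infty]$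 for $y\in\mathbb{C}^n$. The proper set of definition for $v_X^\Phi$ is the set of those $y\in\mathbb{C}^n$ for which there is $\hat{x}\in X$ with $v_X^\Phi(y)=v(\hat{x})+\Phi(y-\hat{x})$. In $[u+g]_U^\Phi$ the function $g$ is restricted to $U$. (iv) $\Phi$ is semiconvex with constant $\delta>0$ if $\Phi+\delta\|\cdot\|^2$ is convex on $\mathbb{C}^n$, where $\|\cdot\|$ is the Euclidean norm. Convention: a function with values in $[-\infty,\infty)$ that is identically $-\infty$ (a constant function) is regarded as continuous. *)

(* Defs.v *)
From HB Require Import structures.
From mathcomp Require Import all_boot all_order all_algebra.
From mathcomp Require Import complex.
From mathcomp Require Import all_classical all_reals all_analysis.

Set Implicit Arguments.
Unset Strict Implicit.
Unset Printing Implicit Defensive.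

Import Order.TTheory GRing.Theory Num.Theory numFieldNormedType.Exports.

Local Open Scope classical_set_scope.
Local Open Scope sesquilinear_scope.
Local Open Scope complex_scope.
Local Open Scope ring_scope.

(* The usual topology of C, read off the norm of the field R[i]; C^n is
   'cV[R[i]]_n with the product topology. *)
#[warnings="-redundant-canonical-projection"]
HB.instance Definition _ (R : realType) := GRing.ComAlgebra.copy R[i] R[i]^o.
#[warnings="-redundant-canonical-projection"]
HB.instance Definition _ (R : realType) := Vector.copy R[i] R[i]^o.
#[warnings="-redundant-canonical-projection"]
HB.instance Definition _ (R : realType) := NormedModule.copy R[i] R[i]^o.

(* Functions with values in [-oo, +oo) are total functions into \bar R that are
   assumed to avoid +oo on the set where they are considered; their values
   outside that set are irrelevant. *)
Definition usc_on (R : realType) (T : topologicalType) (X : set T)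
    (f : T -> \bar R) : Prop :=
  (forall x, X x -> (f x < +oo)%E) /\
  (forall x (a : R), X x -> (f x < a%:E)%E ->
     \forall y \near within X (nbhs x), (f y < a%:E)%E).

(* The library norm on matrices is the sup norm. *)
Definition enorm (R : realType) (n : nat) (z : 'cV[R[i]]_n) : R :=
  Num.sqrt (\sum_(i < n) (complex.Re (z i 0) ^+ 2 + complex.Im (z i 0) ^+ 2)).

Definition eball (R : realType) (n : nat) (c : 'cV[R[i]]_n) (r : R) :
    set 'cV[R[i]]_n :=
  [set z | enorm (z - c) <= r].

Definition esphere (R : realType) (n : nat) (c : 'cV[R[i]]_n) (r : R) :
    set 'cV[R[i]]_n :=
  [set z | enorm (z - c) = r].

(* Sub-mean value property over all closed discs in the open set D; the
   function that is identically -oo is allowed. *)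
Definition subharmonic (R : realType) (D : set R[i]) (f : R[i] -> \bar R) :
    Prop :=
  usc_on D f /\
  forall (c : R[i]) (r : R), 0 < r -> (forall w, `|w - c| <= r%:C -> D w) ->
    (f c <= ((2 * pi)^-1)%:E *
       \int[lebesgue_measure]_(t in `[0%R, (2 * pi)%R])
         f (c + r%:C * (cos t +i* sin t))%R)%E.

Definition plurisubharmonic (R : realType) (n : nat) (V : set 'cV[R[i]]_n)
    (h : 'cV[R[i]]_n -> \bar R) : Prop :=
  usc_on V h /\
  forall a b : 'cV[R[i]]_n,
    subharmonic [set w | V (a + w *: b)] (fun w => h (a + w *: b)).

(* Continuity of h is for the topology of \bar R, so h may take the value -oo,
   in particular be constant. *)
Definition subpluriharmonic (R : realType) (n : nat) (U : set 'cV[R[i]]_n)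
    (u : 'cV[R[i]]_n -> \bar R) : Prop :=
  usc_on U u /\
  ((forall x, U x -> u x = -oo%E) \/
   forall (c : 'cV[R[i]]_n) (r : R), 0 < r -> eball c r `<=` U ->
   forall (V : set 'cV[R[i]]_n) (h : 'cV[R[i]]_n -> \bar R),
     open V -> eball c r `<=` V ->
     {within V, continuous h} -> plurisubharmonic V h ->
     exists2 z, esphere c r z &
       forall x, eball c r x -> (u x + h x <= u z + h z)%E).

(* A (q+1)-dimensional affine subspace is identified with C^(q+1) through a
   parametrization w |-> a + M w with orthonormal columns, so that Euclidean
   balls of the subspace correspond to Euclidean balls of C^(q+1). *)
Definition qplurisubharmonic (R : realType) (n q : nat) (U : set 'cV[R[i]]_n)
    (u : 'cV[R[i]]_n -> \bar R) : Prop :=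
  usc_on U u /\
  ((q < n)%N ->
   forall (a : 'cV[R[i]]_n) (M : 'M[R[i]]_(n, q.+1)), M ^t* *m M = 1%:M ->
     subpluriharmonic [set w | U (a + M *m w)] (fun w => u (a + M *m w))).

Definition sup_conv (R : realType) (n : nat) (X : set 'cV[R[i]]_n)
    (v Phi : 'cV[R[i]]_n -> \bar R) (y : 'cV[R[i]]_n) : \bar R :=
  ereal_sup [set (v x + Phi (y - x)%R)%E | x in X].

Definition proper_set (R : realType) (n : nat) (X : set 'cV[R[i]]_n)
    (v Phi : 'cV[R[i]]_n -> \bar R) : set 'cV[R[i]]_n :=
  [set y | exists2 x, X x & sup_conv X v Phi y = (v x + Phi (y - x)%R)%E].

Definition semiconvex (R : realType) (n : nat) (delta : R)
    (Phi : 'cV[R[i]]_n -> R) : Prop :=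
  let f z := Phi z + delta * enorm z ^+ 2 in
  forall (x y : 'cV[R[i]]_n) (t : R), 0 <= t <= 1 ->
    f (t%:C *: x + (1 - t)%:C *: y) <= t * f x + (1 - t) * f y.

(* For Hermitian A the number y^T A (conj y) is real; Re only changes its
   type. *)
Definition herm_form (R : realType) (n : nat) (A : 'M[R[i]]_n)
    (y : 'cV[R[i]]_n) : R :=
  complex.Re ((y^T *m A *m map_mx Num.conj y) 0 0).

(* Main.v *)
Require Import Defs.
From HB Require Import structures.
From mathcomp Require Import all_boot all_order all_algebra.
From mathcomp Require Import complex.
From mathcomp Require Import all_classical all_reals all_analysis.
From mathcomp Require Import measurable_realfun.
From mathcomp Require Import ring lra.

(** The sup-convolution is a supremum of translates of [v] plus constants: with
    [x = y - t] it reads [sup_t (v (y - t) + Phi t)].  Subtracting [g y] turns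
    [v (y - t) = u (y - t) + g (y - t)] into
    [u (y - t) + (g (y - t) - g y)], and since [g] is a Hermitian form the
    bracket is the real part of a complex affine function of [y]
    ([herm_form_translate]).  So the function under study is a supremum of
    translates of [u] perturbed by pluriharmonic functions, each of them
    q-plurisubharmonic where it is defined.

    The translates live on the different sets [U + t], hence it cannot be
    treated as a supremum over one domain.  What is used instead is that at
    every point of the proper set the supremum is attained: the function is
    touched there from below by one of the translates, and continuity then
    suffices ([subpluriharmonic_touching]).  Indeed, if [f + h] violated the
    maximum property on a ball with centre [c], so would [f + h] plus a small
    multiple [e |x - c|^2], which then has an interior maximum point [x0].
    Subtracting [e |x - x0|^2] makes this maximum strict, and
    [e (|x - c|^2 - |x - x0|^2)] is again the real part of an affine function.
    Adding such functions preserves continuous plurisubharmonic functions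
    ([plurisubharmonic_add_affine]), so the function touching [f] at [x0] would
    have a strict local maximum at [x0] after the addition of an admissible
    [h], which contradicts its subpluriharmonicity on a small ball.

    Continuity comes from the kernel.  Semiconvexity of [Phi] makes the
    sup-convolution plus [delta |y|^2] convex ([sup_conv_convex]); a convex
    function is upper semicontinuous at interior points of its domain
    ([convex_usc_at]), and a supremum of continuous functions is lower
    semicontinuous. *)

Set Implicit Arguments.
Unset Strict Implicit.
Unset Printing Implicit Defensive.

Import Order.TTheory GRing.Theory Num.Theory numFieldNormedType.Exports.

Local Open Scope classical_set_scope.
Local Open Scope complex_scope.
Local Open Scope ring_scope.
Local Open Scope sesquilinear_scope.

(** * Real and imaginary parts *)

Lemma ReD (R : realType) (x y : R[i]) :
  complex.Re (x + y) = complex.Re x + complex.Re y.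
Proof. by case: x; case: y. Qed.

Lemma ReN (R : realType) (x : R[i]) : complex.Re (- x) = - complex.Re x.
Proof. by case: x. Qed.

Lemma ReM (R : realType) (x y : R[i]) :
  complex.Re (x * y) =
  complex.Re x * complex.Re y - complex.Im x * complex.Im y.
Proof. by case: x; case: y. Qed.

Lemma ReJ (R : realType) (x : R[i]) : complex.Re (Num.conj x) = complex.Re x.
Proof. by case: x. Qed.

Lemma Re_sum (R : realType) (I : finType) (f : I -> R[i]) :
  complex.Re (\sum_i f i) = \sum_i complex.Re (f i).
Proof. by apply: (big_morph _ (@ReD R)). Qed.

Lemma Re_continuous (R : realType) : continuous (@complex.Re R).
Proof.
move=> x A /nbhs_ballP[e /= e0 eA]; apply/nbhs_ballP.
exists e%:C => /=; first by rewrite ltcR.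
move=> y; rewrite /ball /= => xy; apply: eA; rewrite /ball /=.
rewrite -ReN -ReD -ltcR; apply: le_lt_trans xy; exact: normc_ge_Re.
Qed.

Lemma conj_continuous (R : realType) : continuous (@Num.conj R[i]).
Proof.
move=> x A /nbhs_ballP[e /= e0 eA]; apply/nbhs_ballP; exists e => //=.
move=> y; rewrite /ball /= => xy; apply: eA; rewrite /ball /=.
by rewrite -rmorphB norm_conjC.
Qed.

Lemma normc_ge_Im (R : realType) (x : R[i]) : `|complex.Im x|%:C <= `|x|.
Proof. by rewrite normc_def lecR -sqrtr_sqr ler_wsqrtr// lerDr sqr_ge0. Qed.

Lemma sum_continuous_at (K : numFieldType) (T : topologicalType) (I : finType)
    (f : I -> T -> K) x :
  (forall i, {for x, continuous (f i)}) ->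
  {for x, continuous (fun z => \sum_i f i z)}.
Proof.
move=> cf.
exact: (@cvg_big K I _ 0 xpredT (@add_continuous K) _ (nbhs x) (index_enum I) f
  (fun i => f i x) _ (fun i _ => cf i)).
Qed.

(** * The Euclidean norm and the topology of C^n *)

Lemma herm_form_continuous (R : realType) (n : nat) (A : 'M[R[i]]_n) :
  continuous (herm_form A).
Proof.
have -> : herm_form A = @complex.Re R \o
    (fun y : 'cV_n => \sum_j (\sum_k y k 0 * A k j) * Num.conj (y j 0)).
  apply/funext => y; rewrite /herm_form /= mxE; congr complex.Re.
  apply: eq_bigr => j _; rewrite !mxE; congr (_ * _).
  by apply: eq_bigr => k _; rewrite mxE.
move=> y; apply: continuous_comp; last exact: Re_continuous.
have cy k : (fun z : 'cV[R[i]]_n => z k 0) @ y --> y k 0.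
  exact: coord_continuous.
apply: (@sum_continuous_at R[i]) => j; apply: (@cvgM R[i] _ (nbhs y)).
  apply: (@sum_continuous_at R[i]) => k; apply: (@cvgM R[i] _ (nbhs y)) => //.
  exact: cvg_cst.
exact: (cvg_comp _ _ (cy j) (@conj_continuous R _)).
Qed.

Lemma herm_form0 (R : realType) (n : nat) (A : 'M[R[i]]_n) : herm_form A 0 = 0.
Proof. by rewrite /herm_form trmx0 !mul0mx mxE. Qed.

Lemma enorm_ge0 (R : realType) (n : nat) (z : 'cV[R[i]]_n) : 0 <= enorm z.
Proof. exact: sqrtr_ge0. Qed.

Lemma enorm_sqr (R : realType) (n : nat) (z : 'cV[R[i]]_n) :
  enorm z ^+ 2 =
  \sum_(i < n) (complex.Re (z i 0) ^+ 2 + complex.Im (z i 0) ^+ 2).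
Proof.
by rewrite sqr_sqrtr// sumr_ge0// => i _; rewrite addr_ge0// sqr_ge0.
Qed.

(** The squared norm is a Hermitian form, so facts about Hermitian forms, such
    as continuity and the behaviour under translation, apply to it. *)
Lemma enorm_sqr_herm (R : realType) (n : nat) (z : 'cV[R[i]]_n) :
  enorm z ^+ 2 = herm_form 1%:M z.
Proof.
rewrite enorm_sqr /herm_form mulmx1 mxE Re_sum.
apply: eq_bigr => i _; rewrite !mxE ReM ReJ.
by case: (z i 0) => a b /=; rewrite !expr2 mulrN opprK.
Qed.

Lemma enormE (R : realType) (n : nat) (z : 'cV[R[i]]_n) :
  enorm z = Num.sqrt (herm_form 1%:M z).
Proof. by rewrite -enorm_sqr_herm sqrtr_sqr ger0_norm// enorm_ge0. Qed.

Lemma enorm_continuous (R : realType) (n : nat) : continuous (@enorm R n).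
Proof.
have -> : @enorm R n = Num.sqrt \o (herm_form 1%:M).
  by apply/funext => z; rewrite enormE.
move=> z; apply: continuous_comp; first exact: herm_form_continuous.
exact: sqrt_continuous.
Qed.

Lemma enorm0 (R : realType) (n : nat) : enorm (0 : 'cV[R[i]]_n) = 0.
Proof. by rewrite enormE herm_form0 sqrtr0. Qed.

Lemma enorm_sqr_continuous (R : realType) (n : nat) (k : R) :
  continuous (fun z : 'cV[R[i]]_n => k * enorm z ^+ 2).
Proof.
rewrite (_ : (fun z => _) = fun z : 'cV[R[i]]_n => k * herm_form 1%:M z).
  move=> z; apply: (@continuous_comp _ _ _ (herm_form 1%:M) (fun x => k * x)).
    exact: herm_form_continuous.
  exact: mulrl_continuous.
by apply/funext => z; rewrite enorm_sqr_herm.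
Qed.

Lemma enorm_scale (R : realType) (n : nat) (k : R) (z : 'cV[R[i]]_n) :
  enorm (k%:C *: z) = `|k| * enorm z.
Proof.
rewrite /enorm -sqrtr_sqr -sqrtrM ?sqr_ge0// mulr_sumr; congr Num.sqrt.
by apply: eq_bigr => i _; rewrite mxE; case: (z i 0) => a b /=; ring.
Qed.

(** This identity makes the defect of convexity of a semiconvex function depend
    on [x - y] only, hence invariant under translation. *)
Lemma enorm_sqr_conv (R : realType) (n : nat) (t : R) (x y : 'cV[R[i]]_n) :
  enorm (t%:C *: x + (1 - t)%:C *: y) ^+ 2 =
  t * enorm x ^+ 2 + (1 - t) * enorm y ^+ 2 - t * (1 - t) * enorm (x - y) ^+ 2.
Proof.
rewrite !enorm_sqr !mulr_sumr -big_split -sumrB; apply: eq_bigr => i _ /=.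
by rewrite !mxE; case: (x i 0) (y i 0) => a b [c d] /=; ring.
Qed.

Lemma normc_le_enorm (R : realType) (n : nat) (z : 'cV[R[i]]_n) i :
  `|z i 0| <= (enorm z)%:C.
Proof.
have sq_ge0 (w : R[i]) : 0 <= complex.Re w ^+ 2 + complex.Im w ^+ 2.
  by rewrite addr_ge0// sqr_ge0.
by rewrite normc_def lecR ler_wsqrtr// (bigD1 i)//= lerDl sumr_ge0.
Qed.

Lemma subr_continuous (R : realType) (n : nat) (y : 'cV[R[i]]_n) :
  continuous (fun z : 'cV[R[i]]_n => z - y).
Proof.
move=> z; apply: (@cvgB R[i] 'cV[R[i]]_n _ (nbhs z)); first exact: cvg_id.
exact: cvg_cst.
Qed.

Lemma enormB_continuous (R : realType) (n : nat) (c : 'cV[R[i]]_n) :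
  continuous (fun z : 'cV[R[i]]_n => enorm (z - c)).
Proof.
move=> z; apply: (@continuous_comp _ _ _ (fun z : 'cV[R[i]]_n => z - c)).
  exact: subr_continuous.
exact: enorm_continuous.
Qed.

(** Euclidean balls generate the topology, so that all neighbourhoods can be
    handled by means of [enorm] although the library norm is the sup norm. *)
Lemma nbhs_eball (R : realType) (n : nat) (y : 'cV[R[i]]_n)
    (A : set 'cV[R[i]]_n) :
  nbhs y A <-> exists2 r : R, 0 < r & eball y r `<=` A.
Proof.
split.
  move=> /nbhs_ballP[e /=]; rewrite ltcE /= => /andP[/eqP ei e0] eA.
  exists (complex.Re e / 2); first by rewrite divr_gt0.
  move=> z yz; apply: eA; split; first by rewrite ltcE /= ei eqxx e0.
  move=> i j; rewrite ord1 /ball /= -normrN opprB.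
  have -> : e = (complex.Re e)%:C by case: (e) ei => a b /= ->.
  have : `|(z - y) i 0| < (complex.Re e)%:C.
    apply: le_lt_trans (normc_le_enorm _ _) _.
    by rewrite ltcR; apply: le_lt_trans yz _; rewrite ltr_pdivrMr//; lra.
  by rewrite !mxE.
move=> [r r0 rA].
have : nbhs y [set z | enorm (z - y) < r].
  have := @enormB_continuous R n y y [set x | x < r]; apply.
  by rewrite subrr enorm0; exact: lt_nbhsl.
by apply: filterS => z /ltW; exact: rA.
Qed.

Lemma nbhs_eball_interior (R : realType) (n : nat) (c z : 'cV[R[i]]_n) (r : R) :
  enorm (z - c) < r -> nbhs z (eball c r).
Proof.
move=> zr; have := (@enormB_continuous R n c z) [set x | x < r].
by move=> /(_ (lt_nbhsl zr)); apply: (@filterS _ (nbhs z)) => x /ltW.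
Qed.

Lemma enorm_isometry (R : realType) (n m : nat) (M : 'M[R[i]]_(n, m)) z :
  M ^t* *m M = 1%:M -> enorm (M *m z) = enorm z.
Proof.
move=> M1; rewrite !enormE; congr Num.sqrt; rewrite /herm_form !mulmx1.
rewrite trmx_mul map_mxM mulmxA -(mulmxA z^T).
have -> : M^T *m map_mx Num.conj M = 1%:M.
  rewrite -(@map_mx1 _ _ (@Num.conj R[i])) -M1 map_mxM; congr (_ *m _).
  apply/matrixP => i j; rewrite !mxE.
  exact: (esym (conjCK _)).
by rewrite mulmx1.
Qed.

Lemma isometry_continuous (R : realType) (n m : nat) (M : 'M[R[i]]_(n, m))
    (a : 'cV[R[i]]_n) :
  M ^t* *m M = 1%:M -> continuous (fun z : 'cV[R[i]]_m => a + M *m z).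
Proof.
move=> M1 z A /nbhs_eball[r r0 rA]; apply/nbhs_eball; exists r => // y yz.
apply: rA; rewrite /eball /= opprD addrACA subrr add0r -mulmxBr.
by rewrite enorm_isometry.
Qed.

(** A closed ball is a closed subset of the image of a real cube under the
    identification of R^(2n) with C^n. *)
Lemma eball_compact (R : realType) (n : nat) (c : 'cV[R[i]]_n) (r : R) :
  compact (eball c r).
Proof.
pose f (v : 'rV[R]_(n + n)) : 'cV[R[i]]_n :=
  c + \col_i (v 0 (lshift n i) +i* v 0 (rshift n i)).
have cf : continuous f.
  move=> v A /nbhs_eball[e e0 eA].
  have : \forall v' \near v, enorm (f v' - f v) < e.
    pose sq j (v' : 'rV[R]_(n + n)) := (v' 0 j - v 0 j) ^+ 2.
    have csq j : {for v, continuous (sq j)}.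
      apply: (@continuous_comp _ _ _ (fun v' : 'rV[R]_(n + n) => v' 0 j - v 0 j)
        (fun x => x ^+ 2)); last exact: exprn_continuous.
      apply: (@cvgB R R^o _ (nbhs v)); last exact: cvg_cst.
      exact: coord_continuous.
    have cn : {for v, continuous (fun v' => enorm (f v' - f v))}.
      have -> : (fun v' => enorm (f v' - f v)) = Num.sqrt \o
          (fun v' => \sum_i (sq (lshift n i) v' + sq (rshift n i) v')).
        apply/funext => v'; congr Num.sqrt; apply: eq_bigr => i _.
        rewrite /sq !mxE; case: (c i 0) => x y /=.
        by congr (_ ^+ 2 + _ ^+ 2); ring.
      apply: continuous_comp; last exact: sqrt_continuous.
      apply: sum_continuous_at => i.
      by apply: (@cvgD R R^o _ (nbhs v)); exact: csq.
    by have := cn [set x | x < e]; apply; rewrite subrr enorm0; exact: lt_nbhsl.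
  by apply: filterS => v' /ltW; exact: eA.
have cK : compact
    [set v : 'rV[R]_(n + n) | forall i, `[- r, r]%classic (v ord0 i)].
  apply: (@rV_compact R _ (fun=> `[- r, r]%classic)) => i.
  exact: segment_compact.
apply: (subclosed_compact _ (continuous_compact (continuous_subspaceT cf) cK)).
  have -> : eball c r = (fun z => enorm (z - c)) @^-1` [set x | x <= r] by [].
  apply: preimage_closed; last exact: closed_le.
  by move=> z _; exact: enormB_continuous.
move=> z zr; exists (\row_j match fintype.split j with
    | inl i => complex.Re ((z - c) i 0)
    | inr i => complex.Im ((z - c) i 0) end).
  move=> i; rewrite mxE /= in_itv /= -ler_norml.
  have H j : `|(z - c) j 0| <= r%:C.
    by apply: le_trans (normc_le_enorm _ _) _; rewrite lecR.
  case: fintype.split => j; rewrite -lecR; apply: le_trans (H j).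
    exact: normc_ge_Re.
  exact: normc_ge_Im.
apply/matrixP => i j; rewrite ord1 !mxE.
rewrite -(_ : unsplit (inl i) = lshift n i)//.
rewrite -(_ : unsplit (inr i) = rshift n i)// !unsplitK.
rewrite !mxE; case: (z i 0) (c i 0) => x y [x' y'] /=.
by congr (_ +i* _); ring.
Qed.

Lemma esphere_compact (R : realType) (n : nat) (c : 'cV[R[i]]_n) (r : R) :
  compact (esphere c r).
Proof.
apply: (@subclosed_compact _ _ (eball c r)); last 2 first.
- exact: eball_compact.
- by move=> z; rewrite /esphere /eball /= => ->.
have -> : esphere c r = (fun z => enorm (z - c)) @^-1` [set r].
  by apply/seteqP; split.
apply: preimage_closed; first by move=> z _; exact: enormB_continuous.
exact: closed_eq.
Qed.

Lemma esphere_nonempty (R : realType) (n : nat) (c : 'cV[R[i]]_n.+1) (r : R) :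
  0 <= r -> esphere c r !=set0.
Proof.
move=> r0; exists (c + \col_i (if i == 0 then r%:C else 0)).
rewrite /esphere /= addrAC subrr add0r /enorm (bigD1 ord0)//= big1 ?addr0.
  by rewrite mxE eqxx /= expr0n addr0 sqrtr_sqr ger0_norm.
by move=> i i0; rewrite mxE (negPf i0) /= expr0n addr0.
Qed.

(** * Upper semicontinuous functions *)

(** The superlevel sets [f k <= f x], for [k] in [K], form a filter base, as
    they are totally ordered by inclusion; any cluster point of the filter is a
    maximum point by upper semicontinuity. *)
Lemma usc_on_compact_max (R : realType) (T : topologicalType) (K : set T)
    (f : T -> \bar R) :
  compact K -> K !=set0 -> usc_on K f ->
  exists2 z, K z & forall x, K x -> (f x <= f z)%E.
Proof.
move=> cK [k0 Kk0] [flt fusc].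
pose F := [set A : set T |
  exists2 k, K k & forall x, K x -> (f k <= f x)%E -> A x].
have FF : ProperFilter F.
  split; first by move=> [k Kk /(_ k Kk (lexx _))].
  split.
  - by exists k0.
  - move=> A B [k Kk kA] [l Kl lB]; have [kl|/ltW lk] := leP (f k) (f l).
      exists l => // x Kx lx; split; last exact: lB.
      by apply: kA => //; exact: le_trans lx.
    exists k => // x Kx kx; split; first exact: kA.
    by apply: lB => //; exact: le_trans kx.
  - by move=> A B AB [k Kk kA]; exists k => // x Kx kx; exact/AB/kA.
have [] := cK F FF; first by exists k0.
move=> p [Kp clp]; exists p => // k Kk; rewrite leNgt; apply/negP => pk.
have := flt _ Kk; case E : (f k) pk => [a| |]//; last by rewrite ltNge leNye.
move=> pk _.
have /= np := fusc _ _ Kp pk.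
have Fk : F [set x | K x /\ (f k <= f x)%E] by exists k.
have [x [[Kx kx] /(_ Kx)]] := clp _ _ Fk np.
by rewrite -E ltNge kx.
Qed.

Lemma usc_on_add (R : realType) (T : topologicalType) (X : set T)
    (f : T -> \bar R) (l : T -> R) :
  (forall x, X x -> {for x, continuous l}) -> usc_on X f ->
  usc_on X (fun x => f x + (l x)%:E)%E.
Proof.
move=> cl [flt fusc]; split.
  by move=> x Xx; have := flt x Xx; case: (f x) => //= y _; rewrite ltry.
move=> x a Xx fxa.
have [e e0 fe] : exists2 e : R, 0 < e & (f x < (a - l x - e)%:E)%E.
  have := flt x Xx; case: (f x) fxa => [y| |] //; last first.
    by move=> _ _; exists 1 => //; rewrite ltNyr.
  rewrite -EFinD lte_fin => ya _; exists ((a - l x - y) / 2); first lra.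
  by rewrite lte_fin; lra.
have := fusc _ _ Xx fe.
have : \forall y \near within X (nbhs x), `|l x - l y| <= e.
  apply: cvg_within.
  by have /(@cvgrPdist_le R R^o _ (nbhs x)) := cl _ Xx; apply.
apply: filterS2 => y ly; case: (f y) => [z||] //; rewrite ?lte_fin.
  by move: ly; rewrite ler_norml => /andP[ly _] zl; lra.
by move=> _; rewrite ltNyr.
Qed.

Lemma usc_on_sub (R : realType) (T : topologicalType) (X Y : set T)
    (f : T -> \bar R) : X `<=` Y -> usc_on Y f -> usc_on X f.
Proof.
move=> XY [flt fusc]; split; first by move=> x /XY/flt.
move=> x a /XY Yx fxa; have := fusc x a Yx fxa.
by rewrite !near_withinE; apply: filterS => y H /XY.
Qed.

Lemma eq_usc_on (R : realType) (T : topologicalType) (X : set T)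
    (f g : T -> \bar R) :
  (forall x, X x -> f x = g x) -> usc_on X f -> usc_on X g.
Proof.
move=> fg [flt fusc]; split; first by move=> x Xx; rewrite -fg//; exact: flt.
move=> x a Xx; rewrite -fg// => fxa; have := fusc x a Xx fxa.
by rewrite !near_withinE; apply: filterS => y H Xy; rewrite -fg//; exact: H.
Qed.

Lemma continuous_usc_on (R : realType) (T : topologicalType) (X : set T)
    (f : T -> R) :
  (forall x, X x -> {for x, continuous f}) -> usc_on X (EFin \o f).
Proof.
move=> cf; have -> : EFin \o f = (fun x => 0 + (f x)%:E)%E.
  by apply/funext => x /=; rewrite add0e.
by apply: usc_on_add => //; split => // x a _ ?; exact: nearW.
Qed.

(** * Sup-convolutions with a semiconvex kernel *)

(** By convexity the increment of [F] at [y0] along a sum [f s + g s] is at most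
    the mean of the increments along [2 f s] and [2 g s].  This reduces upper
    semicontinuity to the directions of the real coordinate axes, where [F] lies
    below a chord.  The set [S] stands for the domain of finiteness of a convex
    function with values in (-oo, +oo]. *)
Lemma convex_usc_at (R : realType) (n : nat) (S : set 'cV[R[i]]_n)
    (F : 'cV[R[i]]_n -> R) (y0 : 'cV[R[i]]_n) :
  (forall (x y : 'cV[R[i]]_n) (t : R), S x -> S y -> 0 <= t <= 1 ->
    S (t%:C *: x + (1 - t)%:C *: y) /\
    F (t%:C *: x + (1 - t)%:C *: y) <= t * F x + (1 - t) * F y) ->
  nbhs y0 S ->
  forall e : R, 0 < e -> \forall y \near y0, F y <= F y0 + e.
Proof.
move=> convF nS; have S0 := nbhs_singleton nS.
(* The factor k makes this property of f invariant under scaling, as needed for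
   the doubling in goodD. *)
pose good (f : 'cV[R[i]]_n -> 'cV[R[i]]_n) := forall k e : R, 0 < e ->
  exists2 r, 0 < r & forall s, enorm s <= r ->
    S (y0 + k%:C *: f s) /\ F (y0 + k%:C *: f s) <= F y0 + e.
have good0 : good (fun=> 0).
  move=> k e e0; exists 1 => // s _; rewrite scaler0 addr0; split => //.
  by rewrite lerDl ltW.
have goodD f g : good f -> good g -> good (fun s => f s + g s).
  move=> gf gg k e e0.
  have [r r0 rf] := gf (k * 2) e e0; have [r' r0' rg] := gg (k * 2) e e0.
  exists (Num.min r r'); first by rewrite lt_min r0.
  move=> s; rewrite le_min => /andP[/rf[Sf Ff] /rg[Sg Fg]].
  have h01 : 0 <= (2^-1 : R) <= 1 by apply/andP; split; lra.
  have [] := convF _ _ 2^-1 Sf Sg h01.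
  have -> : (2^-1)%:C *: (y0 + (k * 2)%:C *: f s)
      + (1 - 2^-1)%:C *: (y0 + (k * 2)%:C *: g s) = y0 + k%:C *: (f s + g s).
    have -> : 1 - 2^-1 = 2^-1 :> R by lra.
    rewrite !scalerDr !scalerA -!rmorphM addrACA -scalerDl -rmorphD.
    have -> : 2^-1 * (k * 2) = k by lra.
    have -> : 2^-1 + 2^-1 = 1 :> R by lra.
    by rewrite scale1r.
  by move=> SS FF; split => //; apply: le_trans FF _; lra.
have ray (d : 'cV[R[i]]_n) (e : R) : 0 < e -> exists2 r, 0 < r &
    forall m, 0 <= m <= r ->
      S (y0 + m%:C *: d) /\ F (y0 + m%:C *: d) <= F y0 + e.
  move=> e0; have /nbhs_eball[r r0 rS] := nS.
  pose rho := r / (enorm d + 1).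
  have dp : 0 < enorm d + 1 by rewrite ltr_wpDl// enorm_ge0.
  have rho0 : 0 < rho by rewrite divr_gt0.
  have Srho : S (y0 + rho%:C *: d).
    apply: rS; rewrite /eball /= addrAC subrr add0r enorm_scale gtr0_norm//.
    by rewrite /rho mulrAC ler_pdivrMr// ler_pM2l// lerDl.
  pose C := `|F (y0 + rho%:C *: d) - F y0| + 1.
  have C0 : 0 < C by rewrite ltr_wpDl.
  exists (Num.min rho (rho * e / C)).
    by rewrite lt_min rho0 !mulr_gt0// invr_gt0.
  move=> m; rewrite le_min => /and3P[m0 m1 m2].
  have h01 : 0 <= m / rho <= 1.
    by rewrite divr_ge0 ?(ltW rho0)//= ler_pdivrMr// mul1r.
  have [] := convF _ _ (m / rho) Srho S0 h01.
  have -> : (m / rho)%:C *: (y0 + rho%:C *: d) + (1 - m / rho)%:C *: y0 =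
     y0 + m%:C *: d.
    rewrite scalerDr scalerA -rmorphM divfK ?gt_eqF// addrAC -scalerDl -rmorphD.
    by rewrite (addrC (m / rho)) subrK scale1r.
  move=> ? H; split => //; apply: le_trans H _.
  have -> : m / rho * F (y0 + rho%:C *: d) + (1 - m / rho) * F y0 =
    F y0 + m / rho * (F (y0 + rho%:C *: d) - F y0) by ring.
  rewrite lerD2l; apply: (@le_trans _ _ (m / rho * C)).
    apply: ler_wpM2l; first by have /andP[] := h01.
    by apply: le_trans (ler_norm _) _; rewrite lerDl.
  move: m2; rewrite ler_pdivlMr// => m2.
  by rewrite mulrAC ler_pdivrMr// (mulrC e).
have goodl (l : 'cV[R[i]]_n -> R) d : (forall s, `|l s| <= enorm s) ->
    good (fun s => (l s)%:C *: d).
  move=> lle k e e0.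
  have [r r0 rd] := ray d e e0; have [r' r0' rd'] := ray (- d) e e0.
  have kp : 0 < `|k| + 1 by rewrite ltr_wpDl.
  exists (Num.min r r' / (`|k| + 1)); first by rewrite divr_gt0// lt_min r0.
  move=> s; rewrite ler_pdivlMr// le_min => /andP[s1 s2].
  rewrite scalerA -rmorphM.
  have kl : `|k * l s| <= enorm s * (`|k| + 1).
    by rewrite normrM mulrC ler_pM// lerDl.
  have [p|p] := leP 0 (k * l s).
    by apply: rd; rewrite p -(ger0_norm p) (le_trans kl).
  have -> : (k * l s)%:C *: d = (- (k * l s))%:C *: (- d).
    by rewrite rmorphN scaleNr scalerN opprK.
  by apply: rd'; rewrite oppr_ge0 (ltW p) -(ltr0_norm p) (le_trans kl).
pose coords (i : 'I_n) (s : 'cV[R[i]]_n) : 'cV[R[i]]_n :=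
  (complex.Re (s i 0))%:C *: delta_mx i 0
    + (complex.Im (s i 0))%:C *: ('i%C *: delta_mx i 0).
have good_coords t : good (fun s => \sum_(i <- t) coords i s).
  elim: t => [|i t IH].
    rewrite (_ : (fun s => _) = fun=> 0)//.
    by apply/funext => s; rewrite big_nil.
  rewrite (_ : (fun s => _) = fun s => coords i s + \sum_(j <- t) coords j s).
    apply: (goodD _ _ _ IH); apply: (goodD); apply: (goodl) => s; rewrite -lecR.
      exact: le_trans (normc_ge_Re _) (normc_le_enorm _ _).
    exact: le_trans (normc_ge_Im _) (normc_le_enorm _ _).
  by apply/funext => s; rewrite big_cons.
have goodid : good id.
  rewrite (_ : id = fun s => \sum_i coords i s)//.
  apply/funext => s; rewrite [LHS]matrix_sum_delta; apply: eq_bigr => i _.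
  rewrite big_ord1 /coords scalerA -scalerDl; congr (_ *: _).
  by rewrite [LHS]complexE mulrC.
move=> e e0; have [r r0 rP] := goodid 1 e e0.
apply/nbhs_eball; exists r => // y /rP[_].
by rewrite scale1r addrC subrK.
Qed.

(** The translation invariant form of semiconvexity. *)
Lemma semiconvex_ineq (R : realType) (n : nat) (delta : R)
    (Phi : 'cV[R[i]]_n -> R) (x y : 'cV[R[i]]_n) (t : R) :
  semiconvex delta Phi -> 0 <= t <= 1 ->
  Phi (t%:C *: x + (1 - t)%:C *: y) <=
  t * Phi x + (1 - t) * Phi y + delta * (t * (1 - t) * enorm (x - y) ^+ 2).
Proof. by move=> sc t01; have := sc x y t t01; rewrite enorm_sqr_conv; lra. Qed.

Lemma sup_conv_ge (R : realType) (n : nat) (X : set 'cV[R[i]]_n)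
    (v Phi : 'cV[R[i]]_n -> \bar R) x y :
  X x -> (v x + Phi (y - x)%R <= sup_conv X v Phi y)%E.
Proof. by move=> Xx; apply: ereal_sup_ubound; exists x. Qed.

Lemma sup_conv_Ny (R : realType) (n : nat) (X : set 'cV[R[i]]_n)
    (v : 'cV[R[i]]_n -> \bar R) (Phi : 'cV[R[i]]_n -> R) y :
  (forall x, X x -> v x = -oo%E) ->
  sup_conv X v (fun x => (Phi x)%:E) y = -oo%E.
Proof.
move=> vNy; apply/eqP; rewrite -leeNy_eq; apply: ge_ereal_sup => _ [x Xx <-].
by rewrite vNy.
Qed.

Section sup_convolution.
Variables (R : realType) (n : nat) (Phi : 'cV[R[i]]_n -> R) (delta : R).
Variables (X : set 'cV[R[i]]_n) (v : 'cV[R[i]]_n -> \bar R).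
Hypothesis Phi_sc : semiconvex delta Phi.
Hypothesis v_proper : exists2 x, X x & (-oo < v x)%E.
Hypothesis v_lty : forall x, X x -> (v x < +oo)%E.
Let EPhi := fun x => (Phi x)%:E.
Let G := sup_conv X v EPhi.

Lemma sup_conv_gtNy y : (-oo < G y)%E.
Proof.
have [x Xx vx] := v_proper; apply: (lt_le_trans _ (sup_conv_ge v EPhi y Xx)).
by move: vx; case: (v x) => //= r _; rewrite -EFinD ltNyr.
Qed.

Lemma sup_conv_fineK y : (G y < +oo)%E -> (fine (G y))%:E = G y.
Proof. by move=> Gy; rewrite fineK// fin_numElt sup_conv_gtNy. Qed.

(** Every function [y |-> v p + Phi (y - p)] satisfies the inequality of
    [semiconvex_ineq] with an error term independent of [p]; the supremum
    inherits it. *)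
Lemma sup_conv_convex (x y : 'cV[R[i]]_n) (t : R) :
  (G x < +oo)%E -> (G y < +oo)%E -> 0 <= t <= 1 ->
  let F z := fine (G z) + delta * enorm z ^+ 2 in
  (G (t%:C *: x + (1 - t)%:C *: y)%R < +oo)%E /\
  F (t%:C *: x + (1 - t)%:C *: y) <= t * F x + (1 - t) * F y.
Proof.
move=> Gx Gy t01 F; have /andP[t0 t1] := t01.
suff H : (G (t%:C *: x + (1 - t)%:C *: y)%R <= (t * fine (G x) +
    (1 - t) * fine (G y) + delta * (t * (1 - t) * enorm (x - y) ^+ 2))%:E)%E.
  have Gt := le_lt_trans H (ltry _); split => //.
  rewrite /F enorm_sqr_conv; move: H; rewrite -sup_conv_fineK// lee_fin; lra.
apply: ge_ereal_sup => _ [p Xp <-].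
have := sup_conv_ge v EPhi x Xp; have := sup_conv_ge v EPhi y Xp.
rewrite -/G -(sup_conv_fineK Gx) -(sup_conv_fineK Gy).
have := v_lty Xp; case: (v p) => [a _|//|]; last by move=> *; rewrite leNye.
rewrite /EPhi -!EFinD !lee_fin => hy hx.
have := semiconvex_ineq (x - p) (y - p) Phi_sc t01.
have -> : t%:C *: (x - p) + (1 - t)%:C *: (y - p) =
    t%:C *: x + (1 - t)%:C *: y - p.
  rewrite !scalerBr addrACA -opprD -scalerDl -rmorphD addrC.
  by rewrite [t + _]addrC subrK scale1r addrC.
rewrite opprB addrA subrK.
have tc0 : 0 <= 1 - t by lra.
have := ler_wpM2l t0 hx; have := ler_wpM2l tc0 hy; lra.
Qed.

(** Upper semicontinuity is that of a convex function; lower semicontinuity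
    holds because some [v x + Phi (z - x)], continuous in [z], is almost optimal
    at [y]. *)
Lemma sup_conv_continuous_at y : continuous Phi ->
  nbhs y [set z | (G z < +oo)%E] -> {for y, continuous (fine \o G)}.
Proof.
move=> cPhi nG; apply/(@cvgrPdist_le R R^o _ (nbhs y)) => e e0.
have e2 : 0 < e / 2 by rewrite divr_gt0.
have Gy := nbhs_singleton nG.
have usc := convex_usc_at sup_conv_convex nG e2.
have csq : \forall z \near y,
    `|delta * enorm y ^+ 2 - delta * enorm z ^+ 2| <= e / 2.
  have := @enorm_sqr_continuous R n delta y.
  by move/(@cvgrPdist_le R R^o _ (nbhs y)); apply.
have [_ [x Xx <-]] : exists2 r, [set (v x + EPhi (y - x)%R)%E | x in X] r &
    (G y - (e / 2)%:E < r)%E.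
  apply: ub_ereal_sup_adherent => //.
  by rewrite -/(sup_conv X v EPhi y) -/G -(sup_conv_fineK Gy).
have := v_lty Xx; case vx : (v x) => [a| |] // _; last by rewrite ltNge leNye.
rewrite -(sup_conv_fineK Gy) /EPhi -!EFinD lte_fin => hx.
have cx : \forall z \near y, `|Phi (y - x) - Phi (z - x)| <= e / 2.
  have : {for y, continuous (fun z : 'cV[R[i]]_n => Phi (z - x))}.
    apply: (@continuous_comp _ _ _ (fun z : 'cV[R[i]]_n => z - x)).
      exact: subr_continuous.
    exact: cPhi.
  by move/(@cvgrPdist_le R R^o _ (nbhs y)); apply.
near=> z => /=.
have Gz : (G z < +oo)%E by near: z.
have := sup_conv_ge v EPhi z Xx.
rewrite -/G -(sup_conv_fineK Gz) vx /EPhi -EFinD lee_fin.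
have : `|delta * enorm y ^+ 2 - delta * enorm z ^+ 2| <= e / 2 by near: z.
have : `|Phi (y - x) - Phi (z - x)| <= e / 2 by near: z.
have : fine (G z) + delta * enorm z ^+ 2 <=
    fine (G y) + delta * enorm y ^+ 2 + e / 2 by near: z.
rewrite !ler_norml => h1 /andP[h2 h3] /andP[h4 h5] h6; apply/andP; split; lra.
Unshelve. all: by end_near. Qed.
End sup_convolution.

(** * Plurisubharmonic functions plus real parts of affine functions *)

Lemma real_complex_continuous (R : realType) : continuous (fun x : R => x%:C).
Proof.
move=> x A /nbhs_ballP[e /=]; rewrite ltcE /= => /andP[/eqP ei e0] eA.
apply/nbhs_ballP; exists (complex.Re e) => //= y xy; apply: eA.
rewrite /ball /= -rmorphB normc_def /= expr0n /= addr0 sqrtr_sqr.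
have -> : e = (complex.Re e)%:C by case: (e) ei => a b /= ->.
by rewrite ltcR.
Qed.

Lemma circle_continuous (R : realType) (c : R[i]) (r : R) :
  continuous (fun t : R => c + r%:C * (cos t +i* sin t)).
Proof.
rewrite (_ : (fun t => _) =
    fun t : R => c + r%:C * ((cos t)%:C + 'i%C * (sin t)%:C)).
  move=> t; apply: (@cvgD R[i] R[i] _ (nbhs t)); first exact: cvg_cst.
  apply: (@cvgM R[i] _ (nbhs t)); first exact: cvg_cst.
  apply: (@cvgD R[i] R[i] _ (nbhs t)).
    exact: (cvg_comp _ _ (@continuous_cos R t) (@real_complex_continuous R _)).
  apply: (@cvgM R[i] _ (nbhs t)); first exact: cvg_cst.
  exact: (cvg_comp _ _ (@continuous_sin R t) (@real_complex_continuous R _)).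
by apply/funext => t; congr (_ + _ * _); exact: complexE.
Qed.

Lemma circle_mem (R : realType) (c : R[i]) (r t : R) :
  0 < r -> `|c + r%:C * (cos t +i* sin t) - c| <= r%:C.
Proof.
move=> r0; rewrite addrAC subrr add0r normc_def lecR /=.
rewrite !mul0r subr0 addr0 !exprMn -mulrDr cos2Dsin2 mulr1 sqrtr_sqr.
by rewrite gtr0_norm.
Qed.

(** The mean value property of real parts of affine functions. *)
Lemma integral_affine_circle (R : realType) (k : R) (b c : R[i]) (r : R) :
  (\int[lebesgue_measure]_(t in `[0%R, (2 * pi)%R])
    (k + complex.Re (b * (c + r%:C * (cos t +i* sin t))))%:E =
  (2 * pi * (k + complex.Re (b * c)))%:E)%E.
Proof.
pose C := k + complex.Re (b * c).
pose b1 := r * complex.Re b; pose b2 := r * complex.Im b.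
pose F (t : R) := C * t + b1 * sin t + b2 * cos t.
pose f (t : R) := C + b1 * cos t - b2 * sin t.
have dF (t : R) : is_derive t 1 F (f t).
  by apply: is_derive_eq; rewrite /f /GRing.scale /=; ring.
have cf : continuous f.
  move=> t; apply: cvgB; last first.
    by apply: cvgM; [exact: cvg_cst|exact: continuous_sin].
  apply: cvgD; first exact: cvg_cst.
  by apply: cvgM; [exact: cvg_cst|exact: continuous_cos].
have cF : continuous F.
  by move=> t; apply/differentiable_continuous/derivable1_diffP; case: (dF t).
transitivity (\int[lebesgue_measure]_(t in `[0%R, (2 * pi)%R]) (f t)%:E)%E.
  apply: eq_integral => t _; congr (_%:E); rewrite /f /C /b1 /b2.
  by case: (b) (c) => x y [x' y'] /=; ring.
rewrite (@continuous_FTC2 _ _ F).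
- have c2 : cos (2 * pi) = 1 :> R by rewrite mulr_natl cos2pi.
  have s2 : sin (2 * pi) = 0 :> R by rewrite mulr_natl sin2pi.
  rewrite -EFinB /F c2 s2 cos0 sin0; congr (_%:E); rewrite -/C; ring.
- by rewrite mulr_gt0// pi_gt0.
- exact: continuous_subspaceT.
- split.
  + by move=> x _; case: (dF x).
  + by apply: cvg_at_right_filter; exact: cF.
  + by apply: cvg_at_left_filter; exact: cF.
- by move=> x _; rewrite derive1E; case: (dF x).
Qed.

(** The positive part is bounded, so an integral above [-oo] bounds the integral
    of the negative part. *)
Lemma integrable_bounded_above (R : realType) (a b : R)
    (F : measurableTypeR R -> \bar R) (B : R) :
  measurable_fun `[a, b] F -> (forall t, `[a, b]%classic t -> F t <= B%:E)%E ->
  (-oo < \int[lebesgue_measure]_(t in `[a, b]) F t)%E ->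
  lebesgue_measure.-integrable `[a, b] F.
Proof.
move=> mF FB iF.
have mI : measurable (`[a, b]%classic : set (measurableTypeR R)).
  exact: measurable_itv.
have icst : lebesgue_measure.-integrable `[a, b] (EFin \o cst `|B|).
  apply: continuous_compact_integrable; first exact: segment_compact.
  exact/continuous_subspaceT/cst_continuous.
have ipos : lebesgue_measure.-integrable `[a, b] F^\+%E.
  apply: le_integrable icst => //; first exact: measurable_funepos.
  move=> t It; rewrite gee0_abs ?funepos_ge0//= normr_id funeposE ge_max.
  by rewrite lee_fin normr_ge0 andbT (le_trans (FB _ It))// lee_fin ler_norm.
have ineg : lebesgue_measure.-integrable `[a, b] F^\-%E.
  apply/integrableP; split; first exact: measurable_funeneg.
  under eq_integral do rewrite gee0_abs ?funeneg_ge0//.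
  have Pfin := integrable_fin_num mI ipos.
  rewrite ltey; apply/eqP => Ny; move: iF.
  by rewrite (integralE _ _ F) Ny -(fineK Pfin).
rewrite (funeposneg F); exact: integrableB.
Qed.

Lemma Re_affine_continuous (R : realType) (k : R) (b : R[i]) :
  continuous (fun w : R[i] => k + complex.Re (b * w)).
Proof.
move=> w; apply: (@cvgD R R^o _ (nbhs w)); first exact: cvg_cst.
apply: (@continuous_comp _ _ _ (fun w => b * w)); last exact: Re_continuous.
exact: mulrl_continuous.
Qed.

(** Where [f c = -oo] there is nothing to prove.  Otherwise the sub-mean value
    inequality keeps the integral of [f] over the circle above [-oo]; then [f]
    is integrable there and the integral of the sum splits. *)
Lemma subharmonic_add_affine (R : realType) (D : set R[i]) (f : R[i] -> \bar R)
    (k : R) (b : R[i]) :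
  subharmonic D f ->
  subharmonic D (fun w => f w + (k + complex.Re (b * w))%:E)%E.
Proof.
move=> [fusc fmean]; split.
  by apply: usc_on_add fusc => w _; exact: Re_affine_continuous.
move=> c r r0 cD; have fc := fmean c r r0 cD; have [flt fusc'] := fusc.
have Dcirc t : D (c + r%:C * (cos t +i* sin t)) by apply/cD/circle_mem.
have pi2 : 0 < 2 * pi :> R by rewrite mulr_gt0// pi_gt0.
pose F (t : measurableTypeR R) := f (c + r%:C * (cos t +i* sin t)).
have Fusc t a : (F t < a%:E)%E -> \forall s \near t, (F s < a%:E)%E.
  move=> Fa; have := fusc' _ _ (Dcirc t) Fa.
  move=> /(@circle_continuous R c r t); apply: (@filterS _ (nbhs t)) => s.
  by apply; exact: Dcirc.
have mF : measurable_fun setT F.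
  have -> : F = (fun t => - (- F t))%E by apply/funext => t; rewrite oppeK.
  apply: measurableT_comp => //; apply: lower_semicontinuous_measurable.
  move=> t a; rewrite lteNr -EFinN => /Fusc Fa; eexists; first exact: Fa.
  by move=> s /=; rewrite lteNr EFinN.
have mI : measurable (`[0%R, 2 * pi]%classic : set (measurableTypeR R)).
  exact: measurable_itv.
have [B FB] : exists B : R,
    forall t, `[0%R, 2 * pi]%classic t -> (F t <= B%:E)%E.
  have [] := @usc_on_compact_max R R `[0%R, 2 * pi]%classic F.
  - exact: segment_compact.
  - by exists 0; rewrite /= in_itv /= lexx ltW.
  - split; first by move=> t _; exact: flt.
    by move=> t a _ /Fusc Fa; apply: cvg_within.
  move=> t0 _ Ft0; have := flt _ (Dcirc t0); rewrite -/(F t0).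
  case: (F t0) Ft0 => [B FB _|//|FB _]; first by exists B.
  by exists 0 => t /FB; rewrite leeNy_eq => /eqP ->; rewrite leNye.
case fcE : (f c) fc => [y| |] fc; last by rewrite leNye.
  have iF : lebesgue_measure.-integrable `[0%R, 2 * pi] F.
    apply: (@integrable_bounded_above R 0 (2 * pi) F B) => //.
      exact: measurable_funTS.
    rewrite ltNye; apply/eqP => iNy; move: fc.
    rewrite [X in (_ * X)%E](_ : _ = -oo%E)//.
    by rewrite gt0_muleNy ?lte_fin ?invr_gt0// leeNy_eq.
  rewrite integralD//; last first.
    apply: continuous_compact_integrable; first exact: segment_compact.
    apply: continuous_subspaceT => t.
    exact: (cvg_comp _ _ (@circle_continuous R c r t)
                         (@Re_affine_continuous R k b _)).
  rewrite integral_affine_circle muleDr//; last first.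
    by rewrite fin_num_adde_defl.
  rewrite -EFinM mulrA mulVf ?mul1r ?gt_eqF//.
  exact: leeD.
have Dc : D c by apply: cD; rewrite subrr normr0 lecR ltW.
by have := flt c Dc; rewrite fcE.
Qed.

Lemma addmxE (V : zmodType) (m n : nat) (A B : 'M[V]_(m, n)) i j :
  (A + B) i j = A i j + B i j.
Proof. by rewrite mxE. Qed.

Lemma oppmxE (V : zmodType) (m n : nat) (A : 'M[V]_(m, n)) i j :
  (- A) i j = - A i j.
Proof. by rewrite mxE. Qed.

Lemma scalemxE (K : pzRingType) (m n : nat) (A : 'M[K]_(m, n)) s i j :
  (s *: A) i j = s * A i j.
Proof. by rewrite mxE. Qed.

(** These are exactly the real affine functions on C^m; writing them as real
    parts of complex affine ones shows their restrictions to complex lines. *)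
Definition affine_re (R : realType) (m : nat) (l : 'cV[R[i]]_m -> R) : Prop :=
  exists k (b : 'rV[R[i]]_m), forall z, l z = k + complex.Re ((b *m z) 0 0).

Lemma affine_reD (R : realType) (m : nat) (l l' : 'cV[R[i]]_m -> R) :
  affine_re l -> affine_re l' -> affine_re (fun z => l z + l' z).
Proof.
move=> [k [b lE]] [k' [b' lE']]; exists (k + k'), (b + b') => z.
by rewrite lE lE' mulmxDl addmxE ReD addrACA.
Qed.

Lemma affine_reZ (R : realType) (m : nat) (s : R) (l : 'cV[R[i]]_m -> R) :
  affine_re l -> affine_re (fun z => s * l z).
Proof.
move=> [k [b lE]]; exists (s * k), (s%:C *: b) => z.
by rewrite lE -scalemxAl scalemxE ReM /= mul0r subr0 mulrDr.
Qed.

Lemma affine_re_cst (R : realType) (m : nat) (s : R) :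
  affine_re (fun _ : 'cV[R[i]]_m => s).
Proof. by exists s, 0 => z; rewrite mul0mx mxE addr0. Qed.

Lemma affine_re_comp (R : realType) (m n : nat) (a : 'cV[R[i]]_n)
    (M : 'M[R[i]]_(n, m)) (l : 'cV[R[i]]_n -> R) :
  affine_re l -> affine_re (fun z => l (a + M *m z)).
Proof.
move=> [k [b lE]]; exists (k + complex.Re ((b *m a) 0 0)), (b *m M) => z.
by rewrite lE mulmxDr addmxE ReD addrA mulmxA.
Qed.

Lemma affine_re_continuous (R : realType) (m : nat) (l : 'cV[R[i]]_m -> R) :
  affine_re l -> continuous l.
Proof.
move=> [k [b lE]] z.
rewrite (_ : l = fun z => k + complex.Re (\sum_j b 0 j * z j 0)); last first.
  by apply/funext => y; rewrite lE mxE.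
apply: (@cvgD R R^o _ (nbhs z)); first exact: cvg_cst.
apply: (@continuous_comp _ _ _ (fun z : 'cV[R[i]]_m => \sum_j b 0 j * z j 0)
  (@complex.Re R)); last exact: Re_continuous.
apply: (@sum_continuous_at R[i]) => j; apply: (@cvgM R[i] _ (nbhs z)).
  exact: cvg_cst.
exact: coord_continuous.
Qed.

(** The quadratic terms cancel, and the conjugate linear term
    [t^T A (conj z)] has the same real part as its conjugate. *)
Lemma herm_form_translate (R : realType) (n : nat) (A : 'M[R[i]]_n)
    (t : 'cV[R[i]]_n) :
  affine_re (fun z => herm_form A (z - t) - herm_form A z).
Proof.
pose b1 := (A *m map_mx Num.conj t)^T; pose b2 := map_mx Num.conj (t^T *m A).
exists (herm_form A t), (- (b1 + b2)) => z.
have h1 : (b1 *m z) 0 0 = (z^T *m A *m map_mx Num.conj t) 0 0.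
  by rewrite /b1 -mulmxA -[z in LHS]trmxK -trmx_mul mxE.
have h2 : complex.Re ((b2 *m z) 0 0) =
    complex.Re ((t^T *m A *m map_mx Num.conj z) 0 0).
  rewrite -[RHS]ReJ !mxE rmorph_sum /=; congr complex.Re; apply: eq_bigr => j _.
  rewrite rmorphM /= /b2 mxE; congr (_ * _); rewrite mxE.
  exact: (esym (conjCK _)).
rewrite mulNmx oppmxE ReN mulmxDl addmxE ReD h1 h2 /herm_form.
rewrite [(z - t)^T]linearB /= map_mxB !mulmxBl !mulmxBr.
rewrite !(addmxE, oppmxE) !(ReD, ReN); ring.
Qed.

Lemma plurisubharmonic_add_affine (R : realType) (m : nat)
    (V : set 'cV[R[i]]_m) (h : 'cV[R[i]]_m -> \bar R) (l : 'cV[R[i]]_m -> R) :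
  affine_re l -> plurisubharmonic V h ->
  plurisubharmonic V (fun z => h z + (l z)%:E)%E.
Proof.
move=> al [husc hsub]; split.
  by apply: usc_on_add husc => z _; exact: affine_re_continuous.
move=> a b; case: al => k [c lE].
rewrite (_ : (fun w : R[i] => _) = fun w => (h (a + w *: b)%R +
    (k + complex.Re ((c *m a) 0 0) + complex.Re ((c *m b) 0 0 * w))%:E)%E).
  exact: subharmonic_add_affine.
apply/funext => w; congr (_ + _%:E)%E.
by rewrite lE mulmxDr addmxE ReD addrA -scalemxAr scalemxE mulrC.
Qed.

Lemma within_continuous_add (R : realType) (n : nat) (V : set 'cV[R[i]]_n)
    (h : 'cV[R[i]]_n -> \bar R) (l : 'cV[R[i]]_n -> R) :
  open V -> continuous l -> {within V, continuous h} ->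
  {within V, continuous (fun x => h x + (l x)%:E)%E}.
Proof.
move=> oV cl ch; apply: continuous_in_subspaceT => x /set_mem Vx.
apply: (@cvgeD _ (nbhs x)) => //.
- by rewrite fin_num_adde_defl.
- by move: ch; rewrite continuous_open_subspace//; apply; exact: mem_set.
- by apply: cvg_EFin; [exact: nearW|exact: cl].
Qed.

(** * Functions touched from below by subpluriharmonic functions *)

Lemma eq_subpluriharmonic (R : realType) (n : nat) (D : set 'cV[R[i]]_n)
    (f g : 'cV[R[i]]_n -> \bar R) :
  (forall x, D x -> f x = g x) -> subpluriharmonic D f -> subpluriharmonic D g.
Proof.
move=> fg [fusc H]; split; first exact: eq_usc_on fusc.
case: H => [Ny|H]; [by left=> x Dx; rewrite -fg// Ny|right].
move=> c r r0 rD V h oV rV ch psh.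
have [z zr zmax] := H c r r0 rD V h oV rV ch psh.
exists z => // x xr; rewrite -!fg; [exact: zmax|apply: rD|exact: rD].
by move: zr; rewrite /esphere /eball /= => ->.
Qed.

(** A continuous function that is touched from below at each point by a
    subpluriharmonic function plus the real part of an affine function is
    itself subpluriharmonic.  A violation of the maximum property is first made
    robust and then turned into a strict local maximum, by quadratic
    perturbations whose difference is affine. *)
Lemma subpluriharmonic_touching (R : realType) (m : nat)
    (D : set 'cV[R[i]]_m.+1) (f : 'cV[R[i]]_m.+1 -> R) :
  (forall x, D x -> {for x, continuous f}) ->
  (forall x0, D x0 -> exists (E : set 'cV[R[i]]_m.+1)
     (s : 'cV[R[i]]_m.+1 -> \bar R) (l : 'cV[R[i]]_m.+1 -> R),
     [/\ nbhs x0 E, subpluriharmonic E s, affine_re l,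
         (s x0 + (l x0)%:E = (f x0)%:E)%E &
         forall x, E x -> D x -> (s x + (l x)%:E <= (f x)%:E)%E]) ->
  subpluriharmonic D (EFin \o f).
Proof.
move=> cf touch; split; first exact: continuous_usc_on.
right => c r r0 rD V h oV rV ch psh.
pose K := eball c r; pose phi x := (h x + (f x)%:E)%E.
have phi_usc : usc_on K phi.
  apply: usc_on_add; first by move=> x /rD; exact: cf.
  by apply: usc_on_sub rV _; case: psh.
have SK : esphere c r `<=` K by move=> x; rewrite /K /esphere /eball /= => ->.
have [z Sz zmax] := usc_on_compact_max (@esphere_compact R _ c r)
  (@esphere_nonempty R _ c r (ltW r0)) (usc_on_sub SK phi_usc).
exists z => // x1 Kx1; rewrite ![((EFin \o f) _ + _)%E]addeC.
rewrite leNgt; apply/negP => zx1; rewrite -/(phi z) -/(phi x1) in zx1.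
(* Adding e |x - c|^2 raises the values on the sphere by e r^2, less than the
   gap between z and x1. *)
have [e e0 he] : exists2 e : R, 0 < e & (phi z + (e * r ^+ 2)%:E < phi x1)%E.
  have := phi_usc.1 _ Kx1; move: zx1; case: (phi x1) => [b| |] //; last first.
    by rewrite ltNge leNye.
  case: (phi z) => [a| |] //; last by move=> _ _; exists 1 => //; rewrite ltNyr.
  rewrite lte_fin => ab _; exists ((b - a) / 2 / r ^+ 2).
    by rewrite !divr_gt0 ?subr_gt0// exprn_gt0.
  by rewrite divfK ?gt_eqF ?exprn_gt0// lte_fin; lra.
pose pe x := (phi x + (e * enorm (x - c) ^+ 2)%:E)%E.
have ce : continuous (fun x : 'cV[R[i]]_m.+1 => e * enorm (x - c) ^+ 2).
  move=> x; apply: (@continuous_comp _ _ _ (fun x : 'cV[R[i]]_m.+1 => x - c)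
    (fun x => e * enorm x ^+ 2)); first exact: subr_continuous.
  exact: enorm_sqr_continuous.
have [x0 Kx0 x0max] : exists2 x0, K x0 & forall x, K x -> (pe x <= pe x0)%E.
  apply: usc_on_compact_max; first exact: eball_compact.
    by exists x1.
  by apply: usc_on_add => // x _; exact: ce.
have x01 : (phi x1 <= pe x0)%E.
  apply: le_trans (x0max _ Kx1); rewrite /pe leeDl// lee_fin.
  by rewrite mulr_ge0 ?(ltW e0)// sqr_ge0.
have x0r : enorm (x0 - c) < r.
  rewrite lt_neqAle; apply/andP; split; last exact: Kx0.
  apply/eqP => x0S; have := lt_le_trans he x01; rewrite /pe x0S.
  by rewrite ltNge leeD2r// zmax.
have [E [s [l [nE [[slt _] sub] al eq0 ineq]]]] := touch x0 (rD _ Kx0).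
have /nbhs_eball[rho rho0 rhoP] : nbhs x0 (E `&` K).
  by apply: filterI => //; exact: nbhs_eball_interior.
have Ex0 := nbhs_singleton nE.
(* Since s + l touches f at x0, the function s + h + l' lies below
   pe - e |x - x0|^2, with equality at x0. *)
pose l' x := l x + e * (enorm (x - c) ^+ 2 - enorm (x - x0) ^+ 2).
have al' : affine_re l'.
  apply: affine_reD => //; apply: affine_reZ.
  have -> : (fun x => enorm (x - c) ^+ 2 - enorm (x - x0) ^+ 2) = (fun x =>
      (herm_form 1%:M (x - c) - herm_form 1%:M x) +
      (-1) * (herm_form 1%:M (x - x0) - herm_form 1%:M x)).
    by apply/funext => x; rewrite !enorm_sqr_herm; ring.
  by apply: affine_reD; [|apply: affine_reZ]; exact: herm_form_translate.
have phi0 : pe x0 \is a fin_num.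
  rewrite fin_numElt; apply/andP; split.
    by apply: lt_le_trans x01; apply: le_lt_trans he; rewrite leNye.
  have := phi_usc.1 _ Kx0; rewrite /pe.
  by case: (phi x0) => //= y _; rewrite ltry.
case: sub => [Ny|sub]; first by move: eq0; rewrite Ny.
have [] := sub x0 rho rho0 _ V (fun x => h x + (l' x)%:E)%E oV.
- by move=> x /rhoP[].
- by move=> x /rhoP[_ /rV].
- apply: within_continuous_add => //; exact: affine_re_continuous.
- exact: plurisubharmonic_add_affine.
move=> z' z'S /(_ x0); rewrite {1}/eball /= subrr enorm0 => /(_ (ltW rho0)).
have [Ez' Kz'] : (E `&` K) z' by apply: rhoP; rewrite /eball /= z'S.
move: (ineq _ Ez' (rD _ Kz')) (x0max _ Kz') (phi_usc.1 _ Kz') phi0 eq0.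
rewrite /pe /phi /l' subrr enorm0 z'S.
have erho : 0 < e * rho ^+ 2 by rewrite mulr_gt0// exprn_gt0.
have := slt _ Ez'; have := slt _ Ex0.
case: (h x0) => [h0| |] //; case: (h z') => [h1| |] //;
  case: (s x0) => [s0| |] //; case: (s z') => [s1| |] //=.
move=> _ _; rewrite -!EFinD !lee_fin => i1 i2 _ _ [] i3 i4.
by exfalso; lra.
Qed.

(** * The sup-convolution of a q-plurisubharmonic function *)

(** At [y0 = a + M z0] the sup-convolution is attained at some [p]; with
    [t = y0 - p] the touching function is the translate of [u] by [t],
    restricted to the slice. *)
Lemma sup_conv_slice (R : realType) (n q : nat) (Phi : 'cV[R[i]]_n -> R)
    (U : set 'cV[R[i]]_n) (u : 'cV[R[i]]_n -> \bar R) (A : 'M[R[i]]_n)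
    (P : set 'cV[R[i]]_n) (w : 'cV[R[i]]_n -> R) a (M : 'M[R[i]]_(n, q.+1)) :
  open U -> (q < n)%N -> qplurisubharmonic q U u -> M ^t* *m M = 1%:M ->
  (forall y, P y -> {for y, continuous w}) ->
  let v := fun x => (u x + (herm_form A x)%:E)%E in
  let EPhi := fun x => (Phi x)%:E in
  P `<=` proper_set U v EPhi ->
  (forall y, P y -> (w y + herm_form A y)%:E = sup_conv U v EPhi y) ->
  subpluriharmonic [set z | P (a + M *m z)] (EFin \o (fun z => w (a + M *m z))).
Proof.
move=> oU qn [_ uq] M1 cw v EPhi PP wE.
have cM b : continuous (fun z : 'cV[R[i]]_q.+1 => b + M *m z).
  exact: isometry_continuous.
apply: subpluriharmonic_touching => [z Pz|z0 Pz0].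
  apply: (@continuous_comp _ _ _ (fun z : 'cV[R[i]]_q.+1 => a + M *m z)).
    exact: cM.
  exact: cw.
have [p Up pE] := PP _ Pz0.
pose t := a + M *m z0 - p.
have tE z : (a - t) + M *m z = a + M *m z - t by rewrite addrAC.
exists [set z | U ((a - t) + M *m z)], (fun z => u ((a - t) + M *m z)),
  (fun z => herm_form A (a + M *m z - t) - herm_form A (a + M *m z) + Phi t).
have yt : a + M *m z0 - t = p by rewrite /t opprB addrC subrK.
split.
- apply: (cM (a - t) z0); apply: open_nbhs_nbhs; split => //=.
  by rewrite tE yt.
- exact: uq.
- apply: affine_reD; last exact: affine_re_cst.
  by apply: (affine_re_comp a M (herm_form_translate A t)).
- have := wE _ Pz0; rewrite pE /v /EPhi -/t tE yt.
  by case: (u p) => //= x [] H; congr (_%:E); lra.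
- move=> z /= Uz Pz; have := sup_conv_ge v EPhi (a + M *m z) Uz.
  rewrite -(wE _ Pz) /v /EPhi tE.
  have -> : a + M *m z - (a + M *m z - t) = t by rewrite opprB addrC subrK.
  case: (u _) => [x| |] //=; last by rewrite !addNye !leNye.
  by rewrite !lee_fin; lra.
Qed.

Theorem corollary4p2 (R : realType) (n q : nat)
    (Phi : 'cV[R[i]]_n -> R) (delta : R)
    (U : set 'cV[R[i]]_n) (u : 'cV[R[i]]_n -> \bar R) (A : 'M[R[i]]_n) :
  continuous Phi -> 0 < delta -> semiconvex delta Phi ->
  open U -> U !=set0 -> qplurisubharmonic q U u ->
  A \is hermsymmx ->
  let g := herm_form A in
  let v := fun x => (u x + (g x)%:E)%E in
  let EPhi := fun x => (Phi x)%:E in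
  let W := interior (proper_set U v EPhi) in
  let w := fun y => (sup_conv U v EPhi y - (g y)%:E)%E in
  W !=set0 ->
  {within W, continuous w} /\ qplurisubharmonic q W w.
Proof.
move=> cPhi _ Phi_sc oU _ uq _ g v EPhi W w _.
have ult x : U x -> (u x < +oo)%E by case: uq => -[+ _] _; exact.
have vlt x : U x -> (v x < +oo)%E.
  by move=> /ult; rewrite /v; case: (u x) => //= y _; rewrite ltry.
have [vNy|] := pselect (forall x, U x -> v x = -oo%E).
  have -> : w = fun=> -oo%E.
    by apply/funext => y; rewrite /w sup_conv_Ny.
  have cstNy (T : topologicalType) (X : set T) :
    usc_on X (fun=> -oo%E : \bar R) by split=> // *; exact: nearW.
  split; first exact/continuous_subspaceT/cst_continuous.
  by split=> // qn a M _; split=> //; left.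
move=> /existsNP[x0 /not_implyP[Ux0 vx0]].
have v_proper : exists2 x, U x & (-oo < v x)%E.
  by exists x0 => //; rewrite ltNye; apply/eqP.
pose G := sup_conv U v EPhi; pose wr y := fine (G y) - g y.
have PG : proper_set U v EPhi `<=` [set y | (G y < +oo)%E].
  move=> y [x Ux /= yx]; rewrite /G yx; have := vlt _ Ux.
  by rewrite /EPhi; case: (v x) => //= r _; rewrite ltry.
have WP : W `<=` proper_set U v EPhi by exact: interior_subset.
have GE y : W y -> (fine (G y))%:E = G y.
  by move=> /WP/PG Gy; exact: (@sup_conv_fineK _ _ Phi _ _ v_proper _ Gy).
have wE y : W y -> (wr y)%:E = w y by move=> Wy; rewrite /w -/G -GE.
have cwr y : W y -> {for y, continuous wr}.
  move=> Wy; apply: (@cvgB R R^o _ (nbhs y)); last exact: herm_form_continuous.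
  apply: (@sup_conv_continuous_at _ _ Phi _ _ _ Phi_sc v_proper vlt _ cPhi).
  by apply: filterS PG _; exact: Wy.
split.
  apply: (@subspace_eq_continuous _ _ _ (EFin \o wr)).
    by move=> y /set_mem Wy; exact: wE.
  apply: continuous_in_subspaceT => y /set_mem Wy.
  apply: (@cvg_EFin R _ (nbhs y)); last exact: cwr.
  by apply: (@filterE _ (nbhs y)).
split; first by apply: (eq_usc_on wE); exact: continuous_usc_on.
move=> qn a M M1.
apply: (@eq_subpluriharmonic _ _ _ (EFin \o (fun z => wr (a + M *m z)))).
  by move=> z; exact: wE.
apply: (sup_conv_slice a oU qn uq M1 cwr WP) => y Wy.
by rewrite /wr subrK GE.
Qed.
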